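(* Let $f:\mathcal{X}\to\mathbb{R}$ and $g:\mathcal{Y}\to\mathbb{R}$ be convex and twice continuously differentiable, let $A:\mathcal{X}\to\mathcal{Y}$ be a bounded linear operator, put $\mathcal{L}(x,y)=f(x)+\langle Ax,y\rangle-g(y)$, and let $(x^*,y^* )\in\mathcal{X}\times\mathcal{Y}$ be a saddle point of $\mathcal{L}$. Let $t_0>0$, $\alpha\ge 3$, $\beta_f,\beta_g,\gamma>0$, $r\ge\max(\beta_f,\beta_g)$ and $\theta=\frac{1}{\alpha-1}$. Let $(x,y):[t_0,\infty)\to\mathcal{X}\times\mathcal{Y}$ be a solution of the system $$\begin{cases}\ddot{x}+\frac{\alpha}{t}\dot{x}+\beta_f\nabla_{xx}\mathcal{L}(x,y)\dot{x}+\left(\gamma+\frac{r}{t}\right)\nabla_x\mathcal{L}(x,y+\theta t\dot{y})=0,\\ \ddot{y}+\frac{\alpha}{t}\dot{y}-\beta_g\nabla_{yy}\mathcal{L}(x,y)\dot{y}-\left(\gamma+\frac{r}{t}\right)\nabla_y\mathcal{L}(x+\theta t\dot{x},y)=0.\end{cases}$$ Then: (i) the trajectory $(x,y)$ is bounded on $[t_0,\infty)$; (ii) $\|\dot{x}(t)\|^2+\|\dot{y}(t)\|^2=\mathcal{O}\left(\frac{1}{t^2}\right)$; (iii) $\mathcal{L}(x(t),y^* )-\mathcal{L}(x^*,y(t))=\mathcal{O}\left(\frac{1}{t^2}\right)$. Here $u(t)=\mathcal{O}(v(t))$ means that there is a constant $C$ independent of $t$ with $|u(t)|\le C\,v(t)$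 for every $t\ge t_0$.
   Context: $\mathcal{X}$ and $\mathcal{Y}$ are real Hilbert spaces; $A^*:\mathcal{Y}\to\mathcal{X}$ is the adjoint of $A$. A saddle point $(x^*,y^* )$ of $\mathcal{L}$ satisfies $\mathcal{L}(x^*,y)\le\mathcal{L}(x^*,y^* )\le\mathcal{L}(x,y^* )$ for all $(x,y)\in\mathcal{X}\times\mathcal{Y}$; equivalently $\nabla f(x^* )+A^*y^*=0$ and $\nabla g(y^* )-Ax^*=0$. The functions $x,y$ are evaluated at $t$ in the system, and a solution is a twice differentiable function satisfying the system on $[t_0,\infty)$. Explicitly, $\nabla_x\mathcal{L}(x,y)=\nabla f(x)+A^*y$, $\nabla_y\mathcal{L}(x,y)=Ax-\nabla g(y)$, $\nabla_{xx}\mathcal{L}(x,y)=\nabla^2 f(x)$, $\nabla_{yy}\mathcal{L}(x,y)=-\nabla^2 g(y)$. *)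

(* Defs.v *)
From HB Require Import structures.
From mathcomp Require Import all_boot all_order all_algebra.
From mathcomp Require Import all_classical all_reals all_analysis.

Set Implicit Arguments.
Unset Strict Implicit.
Unset Printing Implicit Defensive.

Import Order.TTheory GRing.Theory Num.Theory.
Import numFieldNormedType.Exports.

Local Open Scope classical_set_scope.
Local Open Scope ring_scope.

HB.mixin Record CompleteNormedModule_isHilbert (R : realType) V
    of CompleteNormedModule R V := {
  inner : {dot V for (idfun : R -> R)} ;
  sqr_normrE : forall x : V, `|x| ^+ 2 = inner x x
}.

#[short(type="hilbertType")]
HB.structure Definition Hilbert (R : realType) :=
  {V of CompleteNormedModule_isHilbert R V & CompleteNormedModule R V}.

(* The Riesz representative of the differential: for f differentiable at x,
   completeness of X provides exactly one v as below, so that the choice made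
   by get is immaterial. *)
Definition grad (R : realType) (X : hilbertType R) (f : X -> R) (x : X) : X :=
  get [set v : X | forall h : X, 'd (f : X -> R^o) x h = inner v h ].

Definition hess (R : realType) (X : hilbertType R) (f : X -> R) (x : X) : X -> X :=
  'd (grad f) x.

(* The last conjunct is continuity of x |-> hess f x for the operator norm. *)
Definition twice_continuously_differentiable (R : realType) (X : hilbertType R)
    (f : X -> R) : Prop :=
  [/\ forall x : X, differentiable (f : X -> R^o) x,
      forall x : X, differentiable (grad f) x &
      forall (x : X) (e : R), 0 < e ->
        \forall z \near x, forall h : X, `|hess f z h - hess f x h| <= e * `|h| ].

Definition convex (R : realType) (X : hilbertType R) (f : X -> R) : Prop :=
  convex_function [set: convex_lmodType X] (f : convex_lmodType X -> R^o).

Definition bounded_operator (R : realType) (X Y : hilbertType R)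
    (A : {linear X -> Y}) : Prop :=
  exists M : R, forall x : X, `|A x| <= M * `|x|.

Section Lagrangian.
Context (R : realType) (X Y : hilbertType R).
Implicit Types (L : X -> Y -> R) (x : X) (y : Y).

Definition lagrangian (f : X -> R) (g : Y -> R) (A : X -> Y) x y : R :=
  f x + inner (A x) y - g y.

Definition saddle_point L (xs : X) (ys : Y) : Prop :=
  forall x y, L xs y <= L xs ys /\ L xs ys <= L x ys.

Definition grad_x L x y : X := grad (fun u => L u y) x.
Definition grad_y L x y : Y := grad (fun v => L x v) y.
Definition hess_xx L x y : X -> X := hess (fun u => L u y) x.
Definition hess_yy L x y : Y -> Y := hess (fun v => L x v) y.

End Lagrangian.

(* Differentiation relative to D: only increments staying in D are taken into
   account, whence one-sided derivatives at the end points of an interval. *)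
Section derivative_on.
Context (R : realType) (V : normedModType R).
Implicit Types (D : set R) (u : R -> V) (t : R).

Definition derivable_on D u t : Prop :=
  cvg ((s - t)^-1 *: (u s - u t) @[s --> within D t^']).

Definition derive_on D u t : V :=
  lim ((s - t)^-1 *: (u s - u t) @[s --> within D t^']).

Definition twice_differentiable_on D u : Prop :=
  forall t, D t -> derivable_on D u t /\ derivable_on D (derive_on D u) t.

End derivative_on.

Section solution.
Context (R : realType) (X Y : hilbertType R).

(* x and y are functions on the whole of R, but their values below t0 play no
   role: derivatives are relative to `[t0, +oo[. *)
Definition solution (L : X -> Y -> R) (t0 alpha betaf betag gamma r theta : R)
    (x : R -> X) (y : R -> Y) : Prop :=
  let D := [set` `[t0, +oo[] in
  let x' := derive_on D x in let x'' := derive_on D x' in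
  let y' := derive_on D y in let y'' := derive_on D y' in
  [/\ twice_differentiable_on D x, twice_differentiable_on D y &
    forall t : R, D t ->
      x'' t + (alpha / t) *: x' t
        + betaf *: hess_xx L (x t) (y t) (x' t)
        + (gamma + r / t) *: grad_x L (x t) (y t + (theta * t) *: y' t) = 0
      /\
      y'' t + (alpha / t) *: y' t
        - betag *: hess_yy L (x t) (y t) (y' t)
        - (gamma + r / t) *: grad_y L (x t + (theta * t) *: x' t) (y t) = 0 ].

End solution.

Definition bigO_on (R : realType) (D : set R) (u v : R -> R) : Prop :=
  exists C : R, forall t : R, D t -> `|u t| <= C * v t.

(* Main.v *)
From HB Require Import structures.
Require Import Defs.
From mathcomp Require Import all_boot all_order all_algebra.
From mathcomp Require Import all_classical all_reals all_analysis.
From mathcomp Require Import ring lra.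

Set Implicit Arguments.
Unset Strict Implicit.
Unset Printing Implicit Defensive.

Import Order.TTheory GRing.Theory Num.Theory.
Import numFieldNormedType.Exports.

Local Open Scope classical_set_scope.
Local Open Scope ring_scope.

(* Put v = x - xs + theta t x' and w = y - ys + theta t y'. Since theta alpha =
   1 + theta, the system reads
     v' = - theta t (betaf (grad f x)' + (gamma + r / t) (grad f x + A^* ys + A^* w))
   and symmetrically for w' with - A v, so that the coupling terms cancel in the
   derivative of (|v|^2 + |w|^2) / 2. Adding to it, for each variable, the energy
     theta beta t D + theta^2 t (gamma t + r) G,
   where G is the gap of the convex function u |-> L u ys (resp. v |-> - L xs v)
   and D its Bregman distance to the saddle point, absorbs all remaining terms up
   to nonpositive ones: the conditions r >= beta and theta <= 1 / 2 are those
   making the coefficients of D and G nonpositive. The boundedness of the total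
   energy gives the rate for G and the boundedness of v and w, from which those
   of x, y, t x' and t y' follow. *)

(** * Inner product: bilinearity, Cauchy-Schwarz, continuity *)

Section inner_product.
Context (R : realType) (X : hilbertType R).
Implicit Types (x y z : X) (a : R).

Lemma innerC x y : inner x y = inner y x.
Proof. by have := @hermitian_subproof _ _ _ _ inner x y; rewrite expr0 mul1r. Qed.

Lemma innerDl z x y : inner (x + y) z = inner x z + inner y z.
Proof. by rewrite linearDl. Qed.

Lemma innerDr z x y : inner z (x + y) = inner z x + inner z y.
Proof. by rewrite linearDr. Qed.

Lemma innerZl a x y : inner (a *: x) y = a * inner x y.
Proof. by rewrite linearZl_LR. Qed.

Lemma innerZr a x y : inner x (a *: y) = a * inner x y.
Proof. by rewrite linearZr_LR. Qed.

Lemma innerNl x y : inner (- x) y = - inner x y.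
Proof. by rewrite linearNl. Qed.

Lemma innerNr x y : inner x (- y) = - inner x y.
Proof. by rewrite linearNr. Qed.

Lemma inner0l x : inner 0 x = 0.
Proof. by rewrite linear0l. Qed.

Lemma inner0r x : inner x 0 = 0.
Proof. by rewrite linear0r. Qed.

Definition innerE :=
  (innerDl, innerDr, innerNl, innerNr, innerZl, innerZr, inner0l, inner0r).

Lemma inner_ge0 x : 0 <= inner x x.
Proof. by rewrite -sqr_normrE sqr_ge0. Qed.

Lemma innerP x y : (forall h, inner x h = inner y h) -> x = y.
Proof.
move=> xy; apply/eqP; rewrite -subr_eq0 -normr_eq0 -sqrf_eq0 sqr_normrE.
by rewrite innerDl innerNl xy subrr.
Qed.

(** Cauchy-Schwarz: the squared norm of |y| x - |x| y equals 2 |x| |y| (|x| |y| - <x, y>). *)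
Lemma ler_inner x y : inner x y <= `|x| * `|y|.
Proof.
have [->|x0] := eqVneq x 0; first by rewrite inner0l normr0 mul0r.
have [->|y0] := eqVneq y 0; first by rewrite inner0r normr0 mulr0.
have nx : 0 < `|x| by rewrite normr_gt0.
have ny : 0 < `|y| by rewrite normr_gt0.
have := inner_ge0 (`|y| *: x - `|x| *: y).
rewrite !innerE (innerC y x) -!sqr_normrE => h.
have h' : 0 <= (2 * (`|x| * `|y|)) * (`|x| * `|y| - inner x y).
  by apply: le_trans h _; rewrite le_eqVlt; apply/orP; left; apply/eqP; ring.
by move: h'; rewrite pmulr_rge0 ?subr_ge0// !mulr_gt0.
Qed.

Lemma normr_inner x y : `|inner x y| <= `|x| * `|y|.
Proof.
rewrite ler_norml ler_inner andbT lerNl -innerNl.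
by rewrite (le_trans (ler_inner _ _))// normrN.
Qed.

Lemma cvg_inner (T : Type) (F : set_system T) {FF : Filter F}
    (u v : T -> X) (a b : X) :
  u @ F --> a -> v @ F --> b -> (inner (u t) (v t) : R) @[t --> F] --> (inner a b : R).
Proof.
move=> ua vb; apply/cvgrPdistC_lt => e e0.
(* Eventually |v t| <= |b| + 1; adding 1 also keeps both divisors nonzero. *)
have b1 : 0 < `|b| + 1 by rewrite ltr_wpDl.
have a1 : 0 < `|a| + 1 by rewrite ltr_wpDl.
have d1 : 0 < e / 2 / (`|a| + 1) by rewrite !divr_gt0.
have d2 : 0 < e / 2 / (`|b| + 1) by rewrite !divr_gt0.
near=> t.
have -> : inner (u t) (v t) - inner a b =
    inner (u t - a) (v t) + inner a (v t - b) by rewrite !innerE; ring.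
have h1 : `|v t| <= `|b| + 1.
  rewrite -(subrK b (v t)) addrC (le_trans (ler_normD _ _))// lerD2l.
  by apply: ltW; near: t; apply: cvgr_distC_lt.
have h2 : `|u t - a| < e / 2 / (`|b| + 1).
  by near: t; apply: cvgr_distC_lt.
have h3 : `|v t - b| < e / 2 / (`|a| + 1).
  by near: t; apply: cvgr_distC_lt.
rewrite (le_lt_trans (ler_normD _ _))// [ltRHS](splitr e) ltr_leD//.
  rewrite (le_lt_trans (normr_inner _ _))//.
  rewrite (le_lt_trans (ler_wpM2l _ h1))// -ltr_pdivlMr//.
rewrite (le_trans (normr_inner _ _))// mulrC.
have := ltW h3; rewrite ler_pdivlMr// => h4.
by rewrite (le_trans _ h4)// ler_wpM2l// lerDl.
Unshelve. all: by end_near. Qed.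

End inner_product.

(** * Riesz representation *)

Section riesz.
Context (R : realType) (X : hilbertType R).

(* The representative minimises [|v|^2 - 2 l v]; by the parallelogram law
   every minimising sequence is Cauchy. *)
Lemma riesz (l : {linear X -> R^o}) : continuous l ->
  exists v : X, forall h, l h = inner v h.
Proof.
move=> lc; have [M M0 lM] := linear_lipschitz lc.
have lZ a v : l (a *: v) = a * l v by rewrite linearZ.
have lD v w : l (v + w) = l v + l w by rewrite linearD.
pose J (v : X) : R := inner v v - 2 * l v.
(* J v >= |v|^2 - 2 M |v| = (|v| - M)^2 - M^2. *)
have J_ge v : - M ^+ 2 <= J v.
  rewrite /J -sqr_normrE.
  have := sqr_ge0 (`|v| - M); have := le_trans (ler_norm _) (lM v).
  rewrite -subr_ge0 => ? ?; nra.
pose m := inf (range J).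
have infJ : has_inf (range J).
  split; first by exists (J 0), 0.
  by exists (- M ^+ 2) => _ [v _ <-].
have m_le v : m <= J v by apply: ge_inf; [exact: infJ.2|exists v].
have /choice[u uP] (n : nat) : exists v, J v < m + n.+1%:R^-1.
  have [|_ [v _ <-] ?] := @inf_adherent R (range J) n.+1%:R^-1 _ infJ.
    by rewrite invr_gt0.
  by exists v.
(* The linear parts cancel in J v + J w - 2 J ((v + w) / 2), which equals |v - w|^2 / 2; the
   midpoint value is at least m. *)
have mid v w : `|v - w| ^+ 2 <= 2 * (J v - m) + 2 * (J w - m).
  have := m_le (2^-1 *: (v + w)).
  rewrite sqr_normrE /J lZ lD !innerE (innerC w v).
  lra.
have u_cauchy : cauchy (u @ \oo).
  apply/cauchy_ballP => e e0.
  (* Two excesses over m below e^2 / 4 give |u n - u p|^2 < e^2 through [mid]. *)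
  have e2 : 0 < e ^+ 2 / 4 by rewrite divr_gt0// exprn_gt0.
  have [N _ NP] := near_infty_natSinv_lt (PosNum e2).
  exists ([set u n | n in [set n | (N <= n)%N]], [set u n | n in [set n | (N <= n)%N]]).
    by split; exists N => // n /= Nn; exists n.
  move=> [_ _] [/= [n Nn <-] [p Np <-]]; rewrite -ball_normE /=.
  rewrite -(@ltr_pXn2r _ 2)// ?nnegrE ?(ltW e0)//.
  rewrite (le_lt_trans (mid _ _))//.
  have := NP n Nn; have := NP p Np; have := uP n; have := uP p.
  rewrite /=; set a := n.+1%:R^-1; set b := p.+1%:R^-1; lra.
have /cvg_ex[v uv] : cvg (u @ \oo) by exact/cauchy_cvgP.
have Jv : J v <= m.
  have Ju : J (u n) @[n --> \oo] --> J v.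
    apply: (@cvgB _ _ _ _ _ (fun n => inner (u n) (u n)) (fun n => 2 * l (u n))).
      exact: cvg_inner.
    by apply: cvgMl_tmp; exact: (cvg_comp _ _ uv (lc v)).
  have mu : m + n.+1%:R^-1 @[n --> \oo] --> m + 0.
    by apply: cvgD; [exact: cvg_cst|exact: cvg_harmonic].
  rewrite addr0 in mu; apply: ler_cvg_to Ju mu _.
  by near=> n; exact/ltW/uP.
exists v => h; apply/eqP; rewrite eq_sym -subr_eq0; apply/eqP.
set c := _ - _; pose n := inner h h.
have n0 : 0 <= n by exact: inner_ge0.
have n1 : 0 < n + 1 by rewrite ltr_wpDl.
(* Minimality of v is tested along h. The ideal step is - c / n; dividing by n + 1 instead covers h
   = 0 and still yields 0 <= - (c / (n + 1))^2 (n + 2), hence c = 0. *)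
have := le_trans Jv (m_le (v + (- (c / (n + 1))) *: h)).
rewrite /J lD lZ !innerE (innerC h v) -/n => le0.
have {}le0 : 0 <= - (c / (n + 1)) * (2 * c) + (c / (n + 1)) ^+ 2 * n.
  by move: le0; rewrite -subr_ge0; congr (_ <= _); rewrite /c; ring.
have {le0} : 0 <= - (c / (n + 1)) ^+ 2 * (n + 2).
  move: le0; congr (_ <= _); field.
  by rewrite gt_eqF.
rewrite mulNr oppr_ge0 pmulr_lle0; last by rewrite ltr_wpDl.
move=> c0; have /eqP : (c / (n + 1)) ^+ 2 = 0 by apply/eqP; rewrite eq_le c0 sqr_ge0.
rewrite sqrf_eq0 mulf_eq0 invr_eq0 (gt_eqF n1) orbF => /eqP //.
Unshelve. all: by end_near. Qed.

End riesz.

(** * Gradients, Hessians and the tangent inequality *)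

Section gradient.
Context (R : realType) (X : hilbertType R).
Implicit Types (f : X -> R) (x z h c : X).

(** By [riesz] the set in [grad] is inhabited, so [get] returns one of its elements. *)
Lemma gradP f x : differentiable (f : X -> R^o) x ->
  forall h, 'd (f : X -> R^o) x h = inner (grad f x) h.
Proof.
move=> df; have [v vP] := riesz (diff_continuous df).
by apply: (@getPex _ [set v | forall h, 'd (f : X -> R^o) x h = inner v h]); exists v.
Qed.

Lemma grad_eq f x c : is_diff x (f : X -> R^o) (inner c : X -> R^o) -> grad f x = c.
Proof.
move=> fc; apply: innerP => h.
by rewrite -gradP; [rewrite diff_val|exact: ex_diff].
Qed.

Lemma inner_continuous c : continuous (inner c : X -> R^o).
Proof. by move=> x; apply: cvg_inner; [exact: cvg_cst|exact: cvg_id]. Qed.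

Global Instance is_diff_inner c x : is_diff x (inner c : X -> R^o) (inner c).
Proof.
apply: DiffDef.
  exact/(@linear_differentiable _ _ R^o (inner c))/inner_continuous.
by rewrite (@diff_lin _ _ R^o (inner c)) //; exact: inner_continuous.
Qed.

(** Both partial maps of the Lagrangian have this form, with [a] equal to 1 or -1. *)
Lemma grad_affine f (a k : R) c x : differentiable (f : X -> R^o) x ->
  grad (fun u => a * f u + inner c u + k) x = a *: grad f x + c.
Proof.
move=> df; apply: grad_eq; have /differentiableP ? := df.
have -> : (fun u => a * f u + inner c u + k) =
    a *: (f : X -> R^o) + (inner c : X -> R^o) + cst (k : R^o) by [].
apply: is_diff_eq; apply/funext => h.
by rewrite !fctE gradP// addr0 innerDl innerZl.
Qed.

Lemma hess_affine f (a k : R) c x :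
  (forall u, differentiable (f : X -> R^o) u) -> differentiable (grad f) x ->
  hess (fun u => a * f u + inner c u + k) x = (fun h => a *: hess f x h).
Proof.
move=> df d2f; rewrite /hess.
have -> : grad (fun u => a * f u + inner c u + k) = a *: grad f + cst c.
  by apply/funext => u; rewrite grad_affine.
have /differentiableP ? := d2f.
by rewrite diff_val addr0.
Qed.

(** Convexity between x and z bounds the difference quotient at x in direction z - x by f z - f x;
    then h tends to 0 from the right. *)
Lemma convex_grad f x z : convex f -> differentiable (f : X -> R^o) x ->
  f x + inner (grad f x) (z - x) <= f z.
Proof.
move=> cf df; rewrite -lerBrDl.
have : h^-1 * (f (h *: (z - x) + x) - f x) @[h --> 0^'+] -->
    inner (grad f x) (z - x).
  have fd : derivable (f : X -> R^o) x (z - x) by exact: diff_derivable.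
  rewrite -gradP// -deriveE//.
  apply: cvg_trans fd; apply: cvg_app => A; apply: (@filterS _ (nbhs (0 : R))) => h hA h0.
  by apply: hA; rewrite gt_eqF.
move=> /cvgr_to_le; apply; near=> h.
have h0 : 0 < h by near: h; exact: nbhs_right_gt.
have h1 : h <= 1 by near: h; exact: nbhs_right_le.
have : f (h *: z + (1 - h) *: x) <= h * f z + (1 - h) * f x.
  exact: (cf (Itv01 (ltW h0) h1) z x (in_setT _) (in_setT _)).
have -> : h *: z + (1 - h) *: x = h *: (z - x) + x.
  by rewrite scalerBl scale1r scalerBr addrA addrAC.
by rewrite ler_pdivrMl// => ?; lra.
Unshelve. all: by end_near. Qed.

End gradient.

(** * Derivatives of curves, one-sided at the initial time *)

Section curves.
Context (R : realType) (V : normedModType R).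
Implicit Types (u : R -> V) (t : R) (du : V).

Lemma dnbhs_shift t : t^' = (fun h : R => h + t) @ 0^'.
Proof.
apply/seteqP; split=> A /nbhs_ballP[e /= e0 eA]; apply/nbhs_ballP; exists e => //= s.
  rewrite -ball_normE /= sub0r normrN => se s0; apply: eA.
    by rewrite -ball_normE /= opprD addrCA subrr addr0 normrN.
  by rewrite -subr_eq0 addrK.
rewrite -ball_normE /= => se st; rewrite -(subrK t s); apply: eA.
  by rewrite -ball_normE /= sub0r normrN distrC.
by rewrite subr_eq0.
Qed.

(** Bridge between increments h at 0, used by [is_derive], and quotients in s at t, used by
    [derive_on]. *)
Lemma is_deriveP u t du : is_derive t 1 u du <->
  (s - t)^-1 *: (u s - u t) @[s --> t^'] --> du.
Proof.
have uE : (fun h : R => h^-1 *: ((u \o shift t) (h *: 1) - u t)) =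
    (fun s => (s - t)^-1 *: (u s - u t)) \o (fun h => h + t).
  by apply/funext => h /=; rewrite addrK /shift /= /GRing.scale /= mulr1.
rewrite dnbhs_shift.
split=> [[ud <-]|ud]; first by move: ud; rewrite /derivable /derive uE.
split; rewrite /derivable /derive uE; last exact: cvg_lim.
by apply/cvg_ex; exists du.
Qed.

Lemma derive_onP (D : set R) u t : derivable_on D u t ->
  (s - t)^-1 *: (u s - u t) @[s --> within D t^'] --> derive_on D u t.
Proof. by []. Qed.

(** Points near an interior t all lie in the half-line, so the restricted limit is two-sided. *)
Lemma is_derive_on (t0 : R) u t : t0 < t ->
  derivable_on [set` `[t0, +oo[] u t ->
  is_derive t 1 u (derive_on [set` `[t0, +oo[] u t).
Proof.
move=> t0t /derive_onP uD; apply/is_deriveP; apply: cvg_trans uD.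
apply: cvg_app => A DA.
have t0s : \forall s \near t^', t0 < s by apply: nbhs_dnbhs; exact: lt_nbhsr.
apply: (@filterS2 _ t^' _ _ _ _ _ DA t0s) => s As st; apply: As.
by rewrite /= in_itv /= andbT ltW.
Qed.

(** u s is u t0 plus (s - t0) times a convergent quotient. At t0 this right continuity replaces the
    two-sided derivative. *)
Lemma cvg_derivable_on (t0 : R) u : derivable_on [set` `[t0, +oo[] u t0 ->
  u s @[s --> t0^'+] --> u t0.
Proof.
move=> /derive_onP uD.
have uR : (s - t0)^-1 *: (u s - u t0) @[s --> t0^'+] -->
    derive_on [set` `[t0, +oo[] u t0.
  apply: cvg_trans uD; apply: cvg_app => A DA.
  have {}DA : \forall s \near nbhs t0, s != t0 -> t0 <= s -> A s.
    move: DA; apply: (@filterS _ (nbhs t0)) => s As st0 ts.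
    by apply: As => //; rewrite /= in_itv /= andbT.
  by move: DA; apply: (@filterS _ (nbhs t0)) => s As ts; apply: As; rewrite ?gt_eqF ?ltW.
have s0 : s - t0 @[s --> t0^'+] --> 0.
  rewrite -(subrr t0); apply: cvgB; last exact: cvg_cst.
  exact: cvg_at_right_filter.
rewrite -[X in _ --> X]add0r.
rewrite -[X in _ --> X + _](scale0r (derive_on [set` `[t0, +oo[] u t0)).
refine (cvg_trans _ (cvgD (cvgZ s0 uR) (cvg_cst (u t0)))).
apply: near_eq_cvg; near=> s.
by rewrite fctE /= scalerA mulfV ?scale1r ?subrK// subr_eq0 gt_eqF//.
Unshelve. all: by end_near. Qed.

Lemma is_derive_comp_diff (W : normedModType R) (G : V -> W) u t du :
  differentiable G (u t) -> is_derive t 1 u du ->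
  is_derive t 1 (G \o u) ('d G (u t) du).
Proof.
move=> dG [udt <-]; have du' : differentiable u t by apply/derivable1_diffP.
split; first exact/derivable1_diffP/differentiable_comp.
rewrite deriveE; last exact: differentiable_comp.
by rewrite diff_comp//= deriveE.
Qed.

Lemma is_derive_cvg u t du : is_derive t 1 u du -> u s @[s --> t^'] --> u t.
Proof.
move=> [/derivable1_diffP/differentiable_continuous uc _].
by refine (cvg_trans (cvg_app u _) uc); exact: nbhs_dnbhs.
Qed.

End curves.

(** * Product and chain rules along curves *)

Section curves_hilbert.
Context (R : realType) (X : hilbertType R).
Implicit Types (u v : R -> X) (t : R).

Lemma is_derive_scale (V : normedModType R) (k : R -> R) (u : R -> V) t (dk : R)
    (du : V) :
  is_derive t 1 k dk -> is_derive t 1 u du ->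
  is_derive t 1 (fun s => k s *: u s) (dk *: u t + k t *: du).
Proof.
move=> kd ud; apply/is_deriveP.
have uc := is_derive_cvg ud; move/is_deriveP in kd; move/is_deriveP in ud.
refine (cvg_trans _ (cvgD (cvgZ kd uc) (cvgZ (cvg_cst (k t)) ud))).
apply: near_eq_cvg; near=> s.
rewrite fctE; set c := (s - t)^-1.
have -> : c *: (k s - k t) = c * (k s - k t) by [].
rewrite -scalerA [k t *: (c *: _)]scalerA (mulrC (k t)) -scalerA -scalerDr.
by rewrite scalerBl scalerBr addrA subrK.
Unshelve. all: by end_near. Qed.

Lemma is_derive_inner u v t du dv :
  is_derive t 1 u du -> is_derive t 1 v dv ->
  is_derive t (1 : R) (fun s => inner (u s) (v s) : R^o)
    (inner du (v t) + inner (u t) dv).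
Proof.
move=> ud vd; apply/is_deriveP.
have vc := is_derive_cvg vd; move/is_deriveP in ud; move/is_deriveP in vd.
refine (cvg_trans _ (cvgD (cvg_inner ud vc) (cvg_inner (cvg_cst (u t)) vd))).
apply: near_eq_cvg; near=> s.
by rewrite fctE /= !innerE /GRing.scale /=; ring.
Unshelve. all: by end_near. Qed.

Lemma is_derive_grad_comp (f : X -> R) u t du :
  differentiable (f : X -> R^o) (u t) -> is_derive t 1 u du ->
  is_derive t (1 : R) (fun s => f (u s) : R^o) (inner (grad f (u t)) du).
Proof. by move=> df ud; rewrite -gradP//; exact: is_derive_comp_diff. Qed.

End curves_hilbert.

(** * Monotonicity up to the left end point *)

Section monotonicity.
Context (R : realType).

(** The sign of the derivative gives F t <= F s for t0 < s <= t; then s tends to t0. *)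
Lemma le_at_left_end (F : R -> R) (t0 : R) :
  (forall t, t0 < t -> exists2 d, is_derive t 1 F d & d <= 0) ->
  F s @[s --> t0^'+] --> F t0 ->
  forall t, t0 <= t -> F t <= F t0.
Proof.
move=> dF Ft0 t; rewrite le_eqVlt => /orP[/eqP->//|t0t].
apply: (cvgr_to_ge Ft0); near=> s.
have t0s : t0 < s by near: s; exact: nbhs_right_gt.
have st : s <= t by near: s; exact: nbhs_right_le.
(* The end t + 1 makes t an interior point of the interval. *)
apply: (@ler0_derive1_le_oo _ F t0 (t + 1)) => //.
- by move=> z; rewrite in_itv /= => /andP[/dF[d []]].
- move=> z; rewrite in_itv /= => /andP[/dF[d [_ zd] d0] _].
  by rewrite derive1E zd.
- move=> z; rewrite inE /= in_itv /= => /andP[/dF[d [zd _] _] _].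
  exact/differentiable_continuous/derivable1_diffP.
- by rewrite in_itv /= t0t ltrDl ltr01.
- by rewrite in_itv /= t0s (le_lt_trans st)// ltrDl.
Unshelve. all: by end_near. Qed.

End monotonicity.

(** * Monotone gradient and positive Hessian of a convex function *)

Section convexity.
Context (R : realType) (X : hilbertType R) (f : X -> R).
Context (f_convex : convex f).
Context (f_diff : forall z, differentiable (f : X -> R^o) z).

(** Sum of the tangent inequalities at x and at z. *)
Lemma convex_grad_monotone x z : 0 <= inner (grad f z - grad f x) (z - x).
Proof.
have := convex_grad z f_convex (f_diff x).
have := convex_grad x f_convex (f_diff z).
move: (grad f x) (grad f z) (f x) (f z) => u w a b.
rewrite !(innerDl, innerNl) !(innerDr, innerNr); lra.
Qed.

Lemma convex_hess_ge0 x w : differentiable (grad f) x -> 0 <= inner (hess f x w) w.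
Proof.
move=> d2f; rewrite /hess -deriveE//.
apply: (cvgr_to_ge (cvg_inner (diff_derivable (v := w) d2f) (cvg_cst w))).
near=> h.
have h0 : h != 0 by near: h; exact: nbhs_dnbhs_neq.
(* Multiplying by h^2 treats both signs of h at once and produces the increment h w required by
   monotonicity. *)
rewrite innerZl /= -(@pmulr_rge0 _ (h ^+ 2)) ?exprn_even_gt0//.
have := convex_grad_monotone x (h *: w + x).
by rewrite addrK innerZr; congr (_ <= _); field.
Unshelve. all: by end_near. Qed.

End convexity.

(** * Energy of one variable and its dissipation *)

Section energy.
Context (R : realType) (X : hilbertType R) (f : X -> R) (c p : X).
Context (f_convex : convex f).
Context (f_diff : forall z, differentiable (f : X -> R^o) z).
Context (gradf_diff : forall z, differentiable (grad f) z).

(** One formula for both variables: c is A^* ys for x and - A xs for y. *)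
Definition gap z : R := f z + inner c z - (f p + inner c p).

(* The Bregman distance f p - f z - <grad f z, p - z>, from which c cancels. *)
Definition dual_gap z : R := inner (grad f z + c) (z - p) - gap z.

Context (gap_ge0 : forall z, 0 <= gap z).

(** Tangent inequality at z, evaluated at p. *)
Lemma dual_gap_ge0 z : 0 <= dual_gap z.
Proof.
have := convex_grad p f_convex (f_diff z).
rewrite /dual_gap /gap !innerE; lra.
Qed.

Context (x x' : R -> X) (beta gamma r theta : R).

Let v s := x s - p + (theta * s) *: x' s.

Definition energy s : R :=
  2^-1 * inner (v s) (v s) + theta * beta * s * dual_gap (x s)
  + theta ^+ 2 * s * (gamma * s + r) * gap (x s).

Lemma is_derive_gap (t : R) dx : is_derive t 1 x dx ->
  is_derive t (1 : R) (fun s => gap (x s) : R^o) (inner (grad f (x t) + c) dx).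
Proof.
move=> xd.
have d1 := is_derive_grad_comp (f_diff (x t)) xd.
have d2 := is_derive_inner (is_derive_cst c t (1 : R)) xd.
have := is_deriveB (is_deriveD d1 d2) (is_derive_cst (f p + inner c p : R^o) t (1 : R)).
move=> d; apply: (is_derive_eq d).
by rewrite inner0l add0r subr0 innerDl.
Qed.

(** The terms <grad f x + c, dx> from the product and from [gap] cancel, leaving only the Hessian
    term. *)
Lemma is_derive_dual_gap (t : R) dx : is_derive t 1 x dx ->
  is_derive t (1 : R) (fun s => dual_gap (x s) : R^o) (inner (hess f (x t) dx) (x t - p)).
Proof.
move=> xd.
have d1 := is_deriveD (is_derive_comp_diff (gradf_diff (x t)) xd)
  (is_derive_cst c t (1 : R)).
have d2 := is_deriveB xd (is_derive_cst p t 1).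
have := is_deriveB (is_derive_inner d1 d2) (is_derive_gap xd).
move=> d; apply: (is_derive_eq d).
by rewrite !fctE /= addr0 subr0 addrK.
Qed.

(** The vector [b] stands for the coupling with the other variable. In <v', v>, the terms <hess f x
    x', x - p> and <grad f x + c, x'> cancel against the derivatives of [dual_gap] and [gap], while
    <grad f x + c, x - p> is [dual_gap] + [gap]. *)
Lemma is_derive_energy (t alpha : R) (x'' b : X) :
  0 < t -> theta * (alpha - 1) = 1 ->
  is_derive t 1 x (x' t) -> is_derive t 1 x' x'' ->
  x'' + (alpha / t) *: x' t + beta *: hess f (x t) (x' t)
    + (gamma + r / t) *: (grad f (x t) + c + b) = 0 ->
  is_derive t 1 energy
    (- (theta * t) ^+ 2 * beta * inner (hess f (x t) (x' t)) (x' t)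
     - theta * (gamma * t + r - beta) * dual_gap (x t)
     - theta * (gamma * t + r - theta * (2 * gamma * t + r)) * gap (x t)
     - theta * (gamma * t + r) * inner b (v t)).
Proof.
move=> t0 th xd xd' ode.
have tn0 : t != 0 by rewrite gt_eqF.
have dts a : is_derive t 1 (fun s : R => a * s) a.
  by have := @is_deriveZ R R R id a t 1 1 _; rewrite /GRing.scale /= mulr1; apply.
pose dv := x' t + (theta *: x' t + (theta * t) *: x'').
have vd : is_derive t 1 v dv.
  have d := is_deriveD (is_deriveB xd (is_derive_cst p t 1))
    (is_derive_scale (dts theta) xd').
  by apply: (is_derive_eq d); rewrite subr0.
have dvE : dv = - (theta * t) *: (beta *: hess f (x t) (x' t)
    + (gamma + r / t) *: (grad f (x t) + c + b)).
  (* Testing against an arbitrary w reduces the vector identity to a scalar one. *)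
  apply: innerP => w; have := congr1 (inner^~ w) ode.
  rewrite /dv; set h := hess _ _ _; set u := grad _ _ + c.
  rewrite !innerE => /eqP; rewrite -!addrA addr_eq0 => /eqP ->.
  apply/eqP; rewrite -subr_eq0; apply/eqP.
  (* After x'' is eliminated, only this multiple of x' remains, and its coefficient vanishes. *)
  transitivity ((1 + theta - theta * alpha) * inner (x' t) w); first by field.
  have -> : theta * alpha = 1 + theta by lra.
  by rewrite subrr mul0r.
have kd : is_derive t 1 (fun s : R => theta ^+ 2 * s * (gamma * s + r))
    (theta ^+ 2 * (2 * gamma * t + r)).
  have d := is_deriveM (dts (theta ^+ 2)) (is_deriveD (dts gamma) (is_derive_cst r t 1)).
  apply: (is_derive_eq d); rewrite !fctE /GRing.scale /=; ring.
have d1 := is_deriveZ 2^-1 (is_derive_inner vd vd).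
have d2 := is_deriveM (dts (theta * beta)) (is_derive_dual_gap xd).
have d3 := is_deriveM kd (is_derive_gap xd).
have d := is_deriveD (is_deriveD d1 d2) d3.
apply: (is_derive_eq d).
rewrite (innerC (v t)) dvE /v /dual_gap; set G := gap _; set h := hess _ _ _.
set u := grad _ _ + c; set z := x t - p.
by rewrite /GRing.scale /= !innerE; field.
Qed.

Lemma energy_dissipation (t : R) (h b : X) :
  0 < t -> 0 < theta -> theta <= 2^-1 -> 0 < beta -> beta <= r -> 0 < gamma ->
  0 <= inner h (x' t) ->
  - (theta * t) ^+ 2 * beta * inner h (x' t)
    - theta * (gamma * t + r - beta) * dual_gap (x t)
    - theta * (gamma * t + r - theta * (2 * gamma * t + r)) * gap (x t)
    - theta * (gamma * t + r) * inner b (v t) <=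
  - (theta * (gamma * t + r) * inner b (v t)).
Proof.
move=> t0 th0 th1 b0 br g0 hx.
have gt0 : 0 < gamma * t by rewrite mulr_gt0.
have h1 : 0 <= (theta * t) ^+ 2 * beta * inner h (x' t).
  by rewrite !mulr_ge0 ?sqr_ge0// ltW.
have h2 : 0 <= theta * (gamma * t + r - beta) * dual_gap (x t).
  by rewrite !mulr_ge0 ?dual_gap_ge0 ?(ltW th0)//; lra.
(* The factor is gamma t (1 - 2 theta) + r (1 - theta). *)
have h3 : 0 <= theta * (gamma * t + r - theta * (2 * gamma * t + r)) * gap (x t).
  by rewrite !mulr_ge0 ?(ltW th0)//; nra.
rewrite !mulNr; lra.
Qed.

Lemma cvg_energy (t0 : R) :
  x s @[s --> t0^'+] --> x t0 -> x' s @[s --> t0^'+] --> x' t0 ->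
  energy s @[s --> t0^'+] --> energy t0.
Proof.
move=> xc xc'.
have idc : s @[s --> t0^'+] --> t0 by exact: cvg_at_right_filter.
have gc : gap (x s) @[s --> t0^'+] --> gap (x t0).
  apply: cvgB; last exact: cvg_cst.
  apply: cvgD; last exact: cvg_inner (cvg_cst c) xc.
  by apply: (cvg_comp _ _ xc); exact: differentiable_continuous (f_diff _).
have vc : v s @[s --> t0^'+] --> v t0.
  apply: cvgD; first by apply: cvgB xc _; exact: cvg_cst.
  by apply: cvgZ xc'; exact: cvgMl_tmp.
apply: cvgD.
  apply: cvgD; first by apply: cvgMl_tmp; exact: cvg_inner.
  apply: cvgM; first exact: cvgMl_tmp.
  apply: cvgB gc; apply: cvg_inner; last by apply: cvgB xc _; exact: cvg_cst.
  apply: cvgD; last exact: cvg_cst.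
  by apply: (cvg_comp _ _ xc); exact: differentiable_continuous (gradf_diff _).
apply: cvgM gc; apply: cvgM; first exact: cvgMl_tmp.
by apply: cvgD; [exact: cvgMl_tmp|exact: cvg_cst].
Qed.

Lemma energy_ge_norm (s : R) : 0 < s -> 0 < theta -> 0 < beta -> 0 < gamma -> 0 < r ->
  `|v s| ^+ 2 <= 2 * energy s.
Proof.
move=> /ltW s0 /ltW th0 /ltW b0 /ltW g0 /ltW r0.
have h2 : 0 <= theta * beta * s * dual_gap (x s).
  by rewrite !mulr_ge0 ?dual_gap_ge0.
have h3 : 0 <= theta ^+ 2 * s * (gamma * s + r) * gap (x s).
  by rewrite !mulr_ge0 ?gap_ge0 ?sqr_ge0 ?addr_ge0 ?mulr_ge0.
rewrite sqr_normrE /energy; lra.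
Qed.

(** Of the weight gamma s + r only gamma s is kept: it carries the order s^2 behind the rate. *)
Lemma energy_ge_gap (s : R) : 0 < s -> 0 < theta -> 0 < beta -> 0 < gamma -> 0 < r ->
  theta ^+ 2 * gamma * s ^+ 2 * gap (x s) <= energy s.
Proof.
move=> /ltW s0 /ltW th0 /ltW b0 /ltW g0 /ltW r0.
have h1 := inner_ge0 (v s).
have h2 : 0 <= theta * beta * s * dual_gap (x s).
  by rewrite !mulr_ge0 ?dual_gap_ge0.
have h3 : 0 <= theta ^+ 2 * s * r * gap (x s).
  by rewrite !mulr_ge0 ?gap_ge0 ?sqr_ge0.
have -> : theta ^+ 2 * gamma * s ^+ 2 * gap (x s) =
    theta ^+ 2 * s * (gamma * s + r) * gap (x s) - theta ^+ 2 * s * r * gap (x s).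
  by ring.
rewrite /energy; lra.
Qed.

End energy.

(** * From bounded v to bounded position and velocity *)

Section position.
Context (R : realType) (X : hilbertType R).

(* With c = 1 / theta, the function t^c (|x - p|^2 - M) is nonincreasing. *)
Lemma position_bounded (x x' : R -> X) (p : X) (t0 theta M : R) :
  0 < t0 -> 0 < theta ->
  (forall t, t0 < t -> is_derive t 1 x (x' t)) ->
  x s @[s --> t0^'+] --> x t0 ->
  (forall t, t0 <= t -> `|x t - p + (theta * t) *: x' t| ^+ 2 <= M) ->
  forall t, t0 <= t -> `|x t - p| ^+ 2 <= M + `|x t0 - p| ^+ 2.
Proof.
move=> t00 th0 xd xc vM t t0t.
pose c := theta^-1; have c0 : 0 < c by rewrite invr_gt0.
have M0 : 0 <= M by apply: le_trans (vM t0 (lexx _)); exact: sqr_ge0.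
pose z s := x s - p.
pose F (s : R) : R := s `^ c * (inner (z s) (z s) - M).
pose dF (s : R) : R := s `^ c * (2 * inner (z s) (x' s))
  + (inner (z s) (z s) - M) * (c * s `^ (c - 1)).
have Fd s : t0 < s -> is_derive s 1 F (dF s).
  move=> t0s; have s0 := lt_trans t00 t0s.
  have zd : is_derive s 1 z (x' s).
    have d := is_deriveB (xd s t0s) (is_derive_cst p s (1 : R)).
    by apply: is_derive_eq d _; rewrite subr0.
  have d := is_deriveM (is_derive1_powR c s0)
    (is_deriveB (is_derive_inner zd zd) (is_derive_cst (M : R^o) s (1 : R))).
  apply: is_derive_eq d _.
  by rewrite /dF subr0 (innerC (x' s)) /GRing.scale /= !fctE; ring.
have dF0 s : t0 < s -> dF s <= 0.
  move=> t0s; have s0 := lt_trans t00 t0s.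
  rewrite /dF -(mulr_powRB1 (ltW s0) c0).
  have := vM s (ltW t0s); rewrite -/(z s).
  have := inner_ge0 ((theta * s) *: x' s).
  (* As c theta = 1, dF s is c s^(c - 1) times 2 theta s <z, x'> + |z|^2 - M, which is at most -
     |theta s x'|^2 by the bound on v. *)
  have -> : s * s `^ (c - 1) * (2 * inner (z s) (x' s)) =
      s `^ (c - 1) * c * (2 * (theta * s) * inner (z s) (x' s)).
    by rewrite /c; field; rewrite gt_eqF.
  rewrite (mulrC _ (c * _)) (mulrC c) -mulrDr sqr_normrE.
  move: (z s) (x' s) => u w; rewrite !innerE (innerC w u) => h1 h2.
  by rewrite mulr_ge0_le0 ?mulr_ge0 ?powR_ge0 ?(ltW c0)//; lra.
have Fc : F s @[s --> t0^'+] --> F t0.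
  apply: cvgM.
    have [/derivable1_diffP/differentiable_continuous pc _] := is_derive1_powR c t00.
    exact: cvg_at_right_filter pc.
  apply: cvgB; last exact: cvg_cst.
  by apply: cvg_inner; (apply: cvgB; [exact: xc|exact: cvg_cst]).
have : F t <= F t0.
  apply: (le_at_left_end _ Fc) t0t => s t0s.
  by exists (dF s); [exact: Fd|exact: dF0].
rewrite /F !sqr_normrE -/(z t) -/(z t0) => Ft.
have p0 : 0 < t0 `^ c by rewrite powR_gt0.
have pt : 0 < t `^ c by rewrite powR_gt0// (lt_le_trans t00).
have p0t : t0 `^ c <= t `^ c.
  by rewrite ge0_ler_powR ?nnegrE ?(ltW c0) ?(ltW t00)// (le_trans (ltW t00)).
have z0 := inner_ge0 (z t0).
(* It remains that t0^c (|z t0|^2 - M) <= t^c |z t0|^2, which holds since M >= 0 and t0^c <= t^c. *)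
rewrite -lerBlDl -(ler_pM2l pt) (le_trans Ft)// .
have : 0 <= t0 `^ c * M by rewrite mulr_ge0// ltW.
have : 0 <= (t `^ c - t0 `^ c) * inner (z t0) (z t0) by rewrite mulr_ge0// subr_ge0.
lra.
Qed.

(** theta t x' is the difference of v and x - p, so its square is at most 2 |v|^2 + 2 |x - p|^2. *)
Lemma velocity_bounded (x x' : R -> X) (p : X) (t0 theta M : R) :
  0 < t0 -> 0 < theta ->
  (forall t, t0 < t -> is_derive t 1 x (x' t)) ->
  x s @[s --> t0^'+] --> x t0 ->
  (forall t, t0 <= t -> `|x t - p + (theta * t) *: x' t| ^+ 2 <= M) ->
  forall t, t0 <= t ->
    `|x' t| ^+ 2 <= 2 * (2 * M + `|x t0 - p| ^+ 2) / theta ^+ 2 / t ^+ 2.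
Proof.
move=> t00 th0 xd xc vM t t0t; have t_gt0 := lt_le_trans t00 t0t.
have := position_bounded t00 th0 xd xc vM t0t; have := vM t t0t.
rewrite !ler_pdivlMr ?exprn_gt0// !sqr_normrE.
have := inner_ge0 (x t - p + (theta * t) *: x' t + (x t - p)).
move: (x t - p) (x t0 - p) (x' t) => u u0 w.
rewrite !innerE (innerC w u) => *; lra.
Qed.

End position.

(** * Adjoint of a bounded operator *)

Section adjoint.
Context (R : realType) (X Y : hilbertType R) (A : {linear X -> Y}).

Lemma bounded_operator_continuous : bounded_operator A -> continuous A.
Proof.
move=> [M AM]; apply/bounded_linear_continuous/linear_boundedP.
exists M; split=> [|k Mk z]; first exact: num_real.
by rewrite (le_trans (AM z))// ler_wpM2r// ltW.
Qed.

(** [riesz] is applied for each y and the representatives are collected by choice into a plain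
    function. *)
Lemma adjoint_exists : bounded_operator A ->
  exists B : Y -> X, forall x y, inner (B y) x = inner (A x) y.
Proof.
move=> /bounded_operator_continuous Ac.
suff /choice[B BP] : forall y, exists b : X, forall x, inner b x = inner (A x) y.
  by exists B => x y.
move=> y; pose l x : R^o := inner (A x) y.
have l_lin : linear l by move=> k u v; rewrite /l linearD linearZ /= !innerE.
pose lL : {linear X -> R^o} := HB.pack l (GRing.isLinear.Build _ _ _ _ _ l_lin).
have lc : continuous lL.
  by move=> x; apply: cvg_inner; [exact: Ac|exact: cvg_cst].
by have [b bP] := riesz lc; exists b => x; rewrite -bP.
Qed.

End adjoint.

(** * Partial gradients and Hessians of the Lagrangian *)

Section lagrangian_gradients.
Context (R : realType) (X Y : hilbertType R) (f : X -> R) (g : Y -> R).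
Context (A : {linear X -> Y}) (B : Y -> X).
Context (BP : forall x y, inner (B y) x = inner (A x) y).
Context (f_diff : forall z, differentiable (f : X -> R^o) z).
Context (g_diff : forall z, differentiable (g : Y -> R^o) z).
Let L := lagrangian f g A.

Lemma lagrangian_xE y : L^~ y = (fun u => 1 * f u + inner (B y) u + - g y).
Proof. by apply/funext => u; rewrite /L /lagrangian mul1r BP. Qed.

Lemma lagrangian_yE x : L x = (fun v => -1 * g v + inner (A x) v + f x).
Proof. by apply/funext => v; rewrite /L /lagrangian; ring. Qed.

Lemma grad_x_lagrangian x y : grad_x L x y = grad f x + B y.
Proof. by rewrite /grad_x lagrangian_xE grad_affine// scale1r. Qed.

Lemma grad_y_lagrangian x y : grad_y L x y = A x - grad g y.
Proof. by rewrite /grad_y lagrangian_yE grad_affine// scaleN1r addrC. Qed.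

Lemma hess_xx_lagrangian x y h : differentiable (grad f) x ->
  hess_xx L x y h = hess f x h.
Proof. by move=> d2f; rewrite /hess_xx lagrangian_xE hess_affine// scale1r. Qed.

Lemma hess_yy_lagrangian x y h : differentiable (grad g) y ->
  hess_yy L x y h = - hess g y h.
Proof. by move=> d2g; rewrite /hess_yy lagrangian_yE hess_affine// scaleN1r. Qed.

End lagrangian_gradients.

(** * Summed energy, boundedness and rates *)

Theorem theorem7 (R : realType) (X Y : hilbertType R)
    (f : X -> R) (g : Y -> R) (A : {linear X -> Y})
    (f_convex : convex f) (f_C2 : twice_continuously_differentiable f)
    (g_convex : convex g) (g_C2 : twice_continuously_differentiable g)
    (A_bounded : bounded_operator A)
    (L := lagrangian f g A)
    (xs : X) (ys : Y) (saddle : saddle_point L xs ys)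
    (t0 alpha betaf betag gamma r theta : R)
    (t0_gt0 : 0 < t0) (alpha_ge3 : 3 <= alpha)
    (betaf_gt0 : 0 < betaf) (betag_gt0 : 0 < betag) (gamma_gt0 : 0 < gamma)
    (r_ge : Num.max betaf betag <= r) (thetaE : theta = 1 / (alpha - 1))
    (x : R -> X) (y : R -> Y)
    (xy_sol : solution L t0 alpha betaf betag gamma r theta x y) :
  let D := [set` `[t0, +oo[] in
  let x' := derive_on D x in
  let y' := derive_on D y in
  [/\ [bounded (x t, y t) | t in D],
      bigO_on D (fun t => `|x' t| ^+ 2 + `|y' t| ^+ 2) (fun t => 1 / t ^+ 2) &
      bigO_on D (fun t => L (x t) ys - L xs (y t)) (fun t => 1 / t ^+ 2)].
Proof.
move=> D x' y'.
have [f_diff gradf_diff _] := f_C2; have [g_diff gradg_diff _] := g_C2.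
have [B BP] := adjoint_exists A_bounded.
have BD u w : B (u + w) = B u + B w.
  by apply: innerP => h; rewrite innerDl !BP innerDr.
have [betaf_r betag_r] : betaf <= r /\ betag <= r by apply/andP; rewrite -ge_max.
have r_gt0 : 0 < r by exact: lt_le_trans betaf_r.
have theta_gt0 : 0 < theta by rewrite thetaE divr_gt0//; lra.
have theta_mul : theta * (alpha - 1) = 1 by rewrite thetaE; field; rewrite gt_eqF//; lra.
have theta_le : theta <= 2^-1 by nra.
have [x_twice y_twice ode] := xy_sol.
have D_t0 : D t0 by rewrite /D /= in_itv /= lexx.
have D_gt t : t0 < t -> D t by move=> t0t; rewrite /D /= in_itv /= andbT ltW.
have D_ge t : D t -> t0 <= t by rewrite /D /= in_itv /= andbT.
have gt0 t : t0 <= t -> 0 < t by exact: lt_le_trans.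
have xd t : t0 < t -> is_derive t 1 x (x' t).
  by move=> t0t; apply: (is_derive_on t0t); have [] := x_twice _ (D_gt _ t0t).
have xd' t : t0 < t -> is_derive t 1 x' (derive_on D x' t).
  by move=> t0t; apply: (is_derive_on t0t); have [] := x_twice _ (D_gt _ t0t).
have yd t : t0 < t -> is_derive t 1 y (y' t).
  by move=> t0t; apply: (is_derive_on t0t); have [] := y_twice _ (D_gt _ t0t).
have yd' t : t0 < t -> is_derive t 1 y' (derive_on D y' t).
  by move=> t0t; apply: (is_derive_on t0t); have [] := y_twice _ (D_gt _ t0t).
have [/cvg_derivable_on xc /cvg_derivable_on xc'] := x_twice _ D_t0.
have [/cvg_derivable_on yc /cvg_derivable_on yc'] := y_twice _ D_t0.
pose cx := B ys; pose cy := - A xs.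
have gapxE u : gap f cx xs u = L u ys - L xs ys.
  by rewrite /gap /cx /L /lagrangian !BP; ring.
have gapyE w : gap g cy ys w = L xs ys - L xs w.
  by rewrite /gap /cy /L /lagrangian !innerNl; ring.
have gapx_ge0 u : 0 <= gap f cx xs u.
  by rewrite gapxE subr_ge0; have [] := saddle u ys.
have gapy_ge0 w : 0 <= gap g cy ys w.
  by rewrite gapyE subr_ge0; have [] := saddle xs w.
pose vx s := x s - xs + (theta * s) *: x' s.
pose vy s := y s - ys + (theta * s) *: y' s.
pose E s := energy f cx xs x x' betaf gamma r theta s
  + energy g cy ys y y' betag gamma r theta s.
(* Since y + theta t y' = ys + vy, additivity of B splits off the constant [cx] and leaves the
   coupling B vy. *)
have odex t : t0 < t -> derive_on D x' t + (alpha / t) *: x' t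
    + betaf *: hess f (x t) (x' t)
    + (gamma + r / t) *: (grad f (x t) + cx + B (vy t)) = 0.
  move=> /D_gt/ode[+ _]; rewrite (hess_xx_lagrangian _ BP)// (grad_x_lagrangian _ BP)//.
  rewrite -[grad f (x t) + cx + _]addrA -BD.
  by have -> : ys + vy t = y t + (theta * t) *: y' t by rewrite /vy addrA subrKC.
(* Concavity in y reverses the signs, so the second equation takes the form of the first with
   coupling - A vx. *)
have odey t : t0 < t -> derive_on D y' t + (alpha / t) *: y' t
    + betag *: hess g (y t) (y' t)
    + (gamma + r / t) *: (grad g (y t) + cy + - A (vx t)) = 0.
  move=> /D_gt/ode[_ +]; rewrite hess_yy_lagrangian// grad_y_lagrangian//.
  rewrite scalerN opprK -scalerN opprB.
  rewrite -[grad g (y t) + cy + _]addrA -opprD -linearD.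
  by have -> : xs + vx t = x t + (theta * t) *: x' t by rewrite /vx addrA subrKC.
have E_le t : t0 <= t -> E t <= E t0.
  apply: le_at_left_end => [s t0s|]; last by apply: cvgD; exact: cvg_energy.
  have s0 := gt0 _ (ltW t0s).
  have dx := is_derive_energy xs f_diff gradf_diff s0 theta_mul
    (xd _ t0s) (xd' _ t0s) (odex _ t0s).
  have dy := is_derive_energy ys g_diff gradg_diff s0 theta_mul
    (yd _ t0s) (yd' _ t0s) (odey _ t0s).
  eexists; first exact: is_deriveD dx dy.
  have hx := energy_dissipation f_convex f_diff gapx_ge0 x (B (vy s)) s0
    theta_gt0 theta_le betaf_gt0 betaf_r gamma_gt0
    (convex_hess_ge0 f_convex f_diff (x' s) (gradf_diff (x s))).
  have hy := energy_dissipation g_convex g_diff gapy_ge0 y (- A (vx s)) s0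
    theta_gt0 theta_le betag_gt0 betag_r gamma_gt0
    (convex_hess_ge0 g_convex g_diff (y' s) (gradg_diff (y s))).
  apply: (le_trans (lerD hx hy)).
  (* Both couplings carry the same weight, and <B vy, vx> = <A vx, vy> cancels against - <A vx,
     vy>. *)
  by rewrite BP innerNl mulrN opprK addNr.
pose M := 2 * E t0.
have [vxM vyM] : (forall t, t0 <= t -> `|vx t| ^+ 2 <= M) /\
    (forall t, t0 <= t -> `|vy t| ^+ 2 <= M).
  have vM t : t0 <= t -> `|vx t| ^+ 2 + `|vy t| ^+ 2 <= M.
    move=> t0t; have t_gt0 := gt0 _ t0t.
    have := E_le _ t0t; rewrite /M /E.
    have := energy_ge_norm f_convex f_diff gapx_ge0 x x'
      t_gt0 theta_gt0 betaf_gt0 gamma_gt0 r_gt0.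
    have := energy_ge_norm g_convex g_diff gapy_ge0 y y'
      t_gt0 theta_gt0 betag_gt0 gamma_gt0 r_gt0.
    rewrite -/(vx t) -/(vy t); lra.
  by split=> t /vM; apply: le_trans; rewrite (lerDl, lerDr) sqr_ge0.
have posx := position_bounded t0_gt0 theta_gt0 xd xc vxM.
have posy := position_bounded t0_gt0 theta_gt0 yd yc vyM.
split.
- apply/ex_bound; first exact: globally_properfilter D_t0.
  exists (M + `|x t0 - xs| ^+ 2 + 1 + `|xs|
    + (M + `|y t0 - ys| ^+ 2 + 1 + `|ys|)).
  move=> t /D_ge t0t /=.
  (* s <= s^2 + 1 avoids a square root. *)
  have norm_le (V : normedModType R) (u p : V) (m : R) :
      `|u - p| ^+ 2 <= m -> `|u| <= m + 1 + `|p|.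
    move=> um; rewrite -[u in leLHS](subrK p) (le_trans (ler_normD _ _))// lerD2r.
    have := sqr_ge0 (`|u - p| - 1); nra.
  have hx := norm_le _ _ _ _ (posx t t0t); have hy := norm_le _ _ _ _ (posy t t0t).
  (* The product norm is a maximum, so the sum of the two bounds dominates it. *)
  rewrite prod_normE /= ge_max; apply/andP; split.
    by rewrite (le_trans hx)// lerDl (le_trans _ hy).
  by rewrite (le_trans hy)// lerDr (le_trans _ hx).
- exists (2 * (2 * M + `|x t0 - xs| ^+ 2) / theta ^+ 2
      + 2 * (2 * M + `|y t0 - ys| ^+ 2) / theta ^+ 2) => t /D_ge t0t.
  rewrite ger0_norm ?addr_ge0 ?sqr_ge0// mulrA mulr1 mulrDl lerD//.
    exact: (velocity_bounded t0_gt0 theta_gt0 xd xc vxM).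
  exact: (velocity_bounded t0_gt0 theta_gt0 yd yc vyM).
(* The constant inverts the factor theta^2 gamma of [energy_ge_gap]. *)
exists (E t0 / (theta ^+ 2 * gamma)) => t /D_ge t0t; have t_gt0 := gt0 _ t0t.
have -> : L (x t) ys - L xs (y t) = gap f cx xs (x t) + gap g cy ys (y t).
  by rewrite gapxE gapyE; ring.
rewrite ger0_norm; last exact: addr_ge0.
rewrite mulrA mulr1 ler_pdivlMr ?exprn_gt0// ler_pdivlMr ?mulr_gt0 ?exprn_gt0//.
apply: le_trans (E_le _ t0t).
have := energy_ge_gap f_convex f_diff gapx_ge0 x x'
  t_gt0 theta_gt0 betaf_gt0 gamma_gt0 r_gt0.
have := energy_ge_gap g_convex g_diff gapy_ge0 y y'
  t_gt0 theta_gt0 betag_gt0 gamma_gt0 r_gt0.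
rewrite /E; lra.
Qed.
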